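(* Fix $\varepsilon\in(0,1/4]$. Let $p=p(n)\in[0,1]$ be a sequence of edge-probabilities satisfying $n^{-1}\ll p\ll 1$. Then for infinitely many $n$ there exists $q\in[p(n),2p(n)]$ such that $$\max_{[s,t]}\mathbb{P}\bigl(\gamma(G_{n,q})\in[s,t]\bigr)\le 1-\varepsilon ,$$ where the maximum is taken over all intervals $[s,t]$ of length $t-s\le \varepsilon\log(nq)/(nq^{3/2})$.
   Context: $G_{n,q}$ denotes the binomial random graph on vertex set $[n]=\{1,\dots,n\}$ in which each of the $\binom n2$ possible edges is included independently with probability $q$. A dominating set of a graph $G$ is a set $K\subseteq V(G)$ such that every vertex $v\in V(G)\setminus K$ has at least one neighbor in $K$; the domination number $\gamma(G)$ is the smallest number of vertices of a dominating set of $G$. For sequences of positive reals, $a_n\ll b_n$ means $a_n/b_n\to 0$ as $n\to\infty$. The logarithm is the natural logarithm. *)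

(* Defs.v *)
From mathcomp Require Import all_boot all_order all_algebra.
From mathcomp Require Import all_classical all_reals all_analysis.
From mathcomp Require Import ring.
Set Implicit Arguments.
Unset Strict Implicit.
Unset Printing Implicit Defensive.
Import Order.TTheory GRing.Theory Num.Theory.
Import numFieldNormedType.Exports.
Local Open Scope ring_scope.

Section Domination.
Variable T : finType.
Implicit Types (e : rel T) (K : {set T}).

Definition dominating e K : bool :=
  [forall v, (v \notin K) ==> [exists u, (u \in K) && e v u]].

Lemma dominating_setT e : dominating e [set: T].
Proof. by apply/forallP => v; rewrite finset.in_setT. Qed.

(* The minimum is attained, since [set: T] is always dominating. *)
Definition domination_number e : nat :=
  #|[arg min_(K < [set: T] | dominating e K) #|K|]%N|.

End Domination.

(* The vertex set is 'I_n = {0, ..., n-1}. A graph on it is given by its edge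
   set, a subset of [possible_edges n]. *)
Definition possible_edges (n : nat) : {set {set 'I_n}} :=
  [set e : {set 'I_n} | #|e| == 2%N]%SET.

Definition adj (n : nat) (E : {set {set 'I_n}}) : rel 'I_n :=
  fun u v => [set u; v]%SET \in E.

(* P(G_{n,q} \in A): the edges are independent, so the graph with edge set E
   has probability the product over all possible edges of q or 1 - q. *)
Definition gnp_prob (R : realType) (n : nat) (q : R)
    (A : pred (rel 'I_n)) : R :=
  \sum_(E : {set {set 'I_n}} | (E \subset possible_edges n) && A (adj E))
    \prod_(e in possible_edges n) (if e \in E then q else 1 - q).

Lemma gnp_prob_total (R : realType) (n : nat) (q : R) :
  gnp_prob q (fun _ : rel 'I_n => true) = 1.
Proof.
pose F (e : {set 'I_n}) := if e \in possible_edges n then q else 0.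
pose G (e : {set 'I_n}) := if e \in possible_edges n then 1 - q else 1.
have FG e : F e + G e = 1 by rewrite /F /G; case: ifP => _; ring.
transitivity (\prod_e (F e + G e)); last by rewrite big1.
rewrite bigA_distr /gnp_prob.
rewrite [RHS](bigID
  (fun E : {set {set 'I_n}} => E \subset possible_edges n)) /=.
rewrite [X in _ = _ + X]big1 ?addr0 => [|E /subsetPn[e eE ne]]; last first.
  by rewrite (bigD1 e) //= eE /F (negPf ne) mul0r.
apply: eq_big => [E|E /andP[/fintype.subsetP sE _]]; first by rewrite andbT.
rewrite big_mkcond; apply: eq_bigr => e _; rewrite /F /G.
by case: ifP => // ne; case: ifP => // /sE; rewrite ne.
Qed.

(* a_n << b_n. The sequences are positive; this is only required eventually, so
   that n^-1 qualifies although 0^-1 = 0. As x / 0 = 0 in the library, the limit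
   alone would not exclude b = 0. *)
Definition much_less (R : realType) (a b : nat -> R) : Prop :=
  (\forall n \near \oo, 0 < a n /\ 0 < b n)%classic /\
  (a n / b n @[n --> \oo] --> (0 : R))%classic.

(* Main.v *)
(* If gamma were concentrated for every q in [p, 2p], then moving q by sqrt(p)/n
   changes the distribution of G_{n,q} so little (bounded chi-square divergence)
   that the intervals for q and q + sqrt(p)/n intersect. Crossing [p, 2p] takes
   about n sqrt(p) such steps, each shifting the interval by at most
   log(2np) / (4 n p^(3/2)), so gamma would drop by at most about log(np)/(4p).
   But with L = log(np), gamma(G_{n,p}) exceeds (7/8) L/p by a first moment bound,
   while gamma(G_{n,2p}) is at most (L/2 + O(1))/p, obtained by adding to a fixed
   set of size about log(2np)/(2p) the vertices it does not dominate. Since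
   7/8 > 1/2 + 1/4, this is impossible for large L. *)
Require Import Defs.
From mathcomp Require Import all_boot all_order all_algebra.
From mathcomp Require Import all_classical all_reals all_analysis.
From mathcomp Require Import ring lra.
Import Order.TTheory GRing.Theory Num.Theory.
Import numFieldNormedType.Exports.
Local Open Scope ring_scope.

(** * Product measure on the subsets of a finite set *)

Section RandomSubset.
Context {R : realType} {I : finType}.
Implicit Types (D E S : {set I}) (q : R).

(** An element of E outside D contributes 0, so the weight vanishes unless E lies in D. Sums thus
    run over all sets E and factor by [bigA_distr]. *)
Definition subset_weight D q E : R :=
  \prod_e (if e \in E then if e \in D then q else 0
           else if e \in D then 1 - q else 1).

Lemma subset_weightE D q E : E \subset D ->
  subset_weight D q E = \prod_(e in D) (if e \in E then q else 1 - q).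
Proof.
move=> /fintype.subsetP sED; rewrite [RHS]big_mkcond; apply: eq_bigr => e _.
by case: (boolP (e \in E)) => // /sED ->.
Qed.

Lemma subset_weight_out D q E : ~~ (E \subset D) -> subset_weight D q E = 0.
Proof.
by case/subsetPn=> e eE eND; rewrite /subset_weight (bigD1 e)//= eE (negPf eND) mul0r.
Qed.

Lemma subset_weight_ge0 D q E : 0 <= q <= 1 -> 0 <= subset_weight D q E.
Proof.
case/andP=> q0 q1; apply: prodr_ge0 => e _.
by do 2![case: ifP => _] => //; rewrite subr_ge0.
Qed.

Lemma subset_weight_gt0 D q E : 0 < q < 1 -> E \subset D ->
  0 < subset_weight D q E.
Proof.
case/andP=> q0 q1 sED; rewrite subset_weightE//; apply: prodr_gt0 => e _.
by case: ifP => _ //; rewrite subr_gt0.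
Qed.

Lemma sum_subset_weight D q : \sum_E subset_weight D q E = 1.
Proof.
rewrite -bigA_distr big1// => e _.
by case: ifP => _ /=; ring.
Qed.

Lemma sum_subset_weight_disjoint D S q : S \subset D ->
  \sum_(E : {set I} | [disjoint S & E]) subset_weight D q E = (1 - q) ^+ #|S|.
Proof.
move=> /fintype.subsetP sSD; rewrite -prodr_const.
(* Giving membership weight 0 on S encodes disjointness from S; elsewhere in D the two weights still
   sum to 1. *)
transitivity (\prod_e ((if e \in D :\: S then q else 0) +
                       (if e \in D then 1 - q else 1))); last first.
  rewrite [RHS]big_mkcond; apply: eq_bigr => e _; rewrite finset.in_setD.
  case: (boolP (e \in S)) => [/sSD ->|_] /=; first by rewrite add0r.
  by case: ifP => _; ring.
rewrite bigA_distr [LHS]big_mkcond; apply: eq_bigr => E _.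
case: ifPn => [dSE|].
  apply: eq_bigr => e _; case: ifP => // eE; rewrite finset.in_setD.
  by rewrite (disjointFl dSE eE).
case/pred0Pn=> e /andP[/= eS eE].
by rewrite (bigD1 e)//= eE finset.in_setD eS mul0r.
Qed.

(* The sum is 1 + chi^2 between the two product measures. *)
Lemma sum_subset_weight_sqr D q q' : 0 < q < 1 ->
  \sum_E subset_weight D q' E ^+ 2 / subset_weight D q E =
  (1 + (q' - q) ^+ 2 / (q * (1 - q))) ^+ #|D|.
Proof.
case/andP=> q0 q1; rewrite -prodr_const [RHS]big_mkcond /=.
transitivity (\prod_e ((if e \in D then q' ^+ 2 / q else 0) +
                       (if e \in D then (1 - q') ^+ 2 / (1 - q) else 1))); last first.
  apply: eq_bigr => e _; case: ifP => _; last by rewrite add0r.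
  by field; rewrite subr_eq0 (gt_eqF q1) (gt_eqF q0).
rewrite bigA_distr; apply: eq_bigr => E _.
rewrite -prodrXl -prodf_div; apply: eq_bigr => e _.
by do 2![case: ifP => _] => //; rewrite ?expr0n/= ?mul0r ?expr1n ?mul1r ?invr1.
Qed.

End RandomSubset.

(** * Events of the random graph and change of edge probability *)

Section GnpProb.
Context {R : realType} {n : nat}.
Implicit Types (q : R) (A B : pred (rel 'I_n)).

Lemma gnp_probE q A :
  gnp_prob q A = \sum_(E | A (adj E)) subset_weight (possible_edges n) q E.
Proof.
rewrite /gnp_prob [RHS](bigID (fun E : {set {set 'I_n}} => E \subset possible_edges n)) /=.
rewrite [X in _ = _ + X]big1 ?addr0 => [|E /andP[_ /subset_weight_out//]].
by apply: eq_big => [E|E /andP[/subset_weightE ->]//]; rewrite andbC.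
Qed.

Lemma le_gnp_prob q A B : 0 <= q <= 1 -> (forall e, A e -> B e) ->
  gnp_prob q A <= gnp_prob q B.
Proof.
move=> q01 sAB; rewrite !gnp_probE [leLHS]big_mkcond [leRHS]big_mkcond.
apply: ler_sum => E _; case: ifP => [/sAB ->//|_]; case: ifP => // _.
exact: subset_weight_ge0.
Qed.

Lemma gnp_probC q A : gnp_prob q A + gnp_prob q (predC A) = 1.
Proof.
by rewrite !gnp_probE -(sum_subset_weight (possible_edges n) q)
  [RHS](bigID (fun E : {set {set 'I_n}} => A (adj E))).
Qed.

Lemma gnp_prob_meet q A B : 0 <= q <= 1 ->
  1 < gnp_prob q A + gnp_prob q B -> exists e, A e /\ B e.
Proof.
move=> q01 AB; apply: contrapT => noe.
have sub : gnp_prob q A <= gnp_prob q (predC B).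
  by apply: le_gnp_prob => // e Ae; apply/negP => Be; apply: noe; exists e.
have := gnp_probC q B; lra.
Qed.

(* Summing 2 w' <= 3 w + w'^2 / (3 w) over the weights w, w' of the graphs. *)
Lemma gnp_prob_close q q' A : 0 < q < 1 -> 0 <= q' <= 1 ->
  2 * gnp_prob q' A <= 3 * gnp_prob q A +
    (1 + (q' - q) ^+ 2 / (q * (1 - q))) ^+ #|possible_edges n| / 3.
Proof.
move=> q01 q'01; rewrite !gnp_probE -sum_subset_weight_sqr//.
rewrite mulr_suml !mulr_sumr [leLHS]big_mkcond [X in _ <= X + _]big_mkcond.
rewrite -big_split; apply: ler_sum => E _ /=.
have [sED|nsED] := boolP (E \subset possible_edges n); last first.
  by rewrite !subset_weight_out//; case: ifP => _; lra.
have w0 := subset_weight_gt0 (possible_edges n) q E q01 sED.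
have w'0 := subset_weight_ge0 (possible_edges n) q' E q'01.
move: (subset_weight _ q E) (subset_weight _ q' E) w0 w'0 => w w' w0 w'0.
have r0 : 0 <= w' ^+ 2 / w / 3.
  by rewrite !divr_ge0// ?exprn_ge0// ltW.
case: ifP => _; last by lra.
rewrite -subr_ge0.
have -> : 3 * w + w' ^+ 2 / w / 3 - 2 * w' = (3 * w - w') ^+ 2 / w / 3.
  by field; rewrite gt_eqF.
by rewrite !divr_ge0// ?sqr_ge0// ltW.
Qed.

End GnpProb.

(** * Deterministic bounds on the domination number *)

Section DominationNumber.
Context {T : finType}.
Implicit Types (e : rel T) (K : {set T}).

Lemma domination_number_le e K : dominating e K ->
  (domination_number e <= #|K|)%N.
Proof.
rewrite /domination_number.
by case: arg_minnP => [|K0 _ minK0 /minK0//]; exact: dominating_setT.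
Qed.

Lemma domination_number_attained e :
  exists2 K, dominating e K & #|K| = domination_number e.
Proof.
rewrite /domination_number.
by case: arg_minnP => [|K domK _]; [exact: dominating_setT|exists K].
Qed.

(** K together with the vertices it leaves undominated is a dominating set. *)
Lemma domination_number_le_undominated e K :
  (domination_number e <=
   #|K| + #|[set v | (v \notin K) && ~~ [exists u, (u \in K) && e v u]]%SET|)%N.
Proof.
set N := [set v | _]%SET.
apply: leq_trans (leq_card_setU K N); apply: domination_number_le.
apply/forallP => v; apply/implyP; rewrite finset.in_setU negb_or => /andP[vK].
rewrite finset.inE vK /= negbK => /existsP[u /andP[uK evu]].
by apply/existsP; exists u; rewrite finset.in_setU uK.
Qed.

End DominationNumber.

(** * Edges between two disjoint vertex sets *)

Section Cut.
Context {n : nat}.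
Implicit Types (K V : {set 'I_n}) (E : {set {set 'I_n}}).

Definition cut K V : {set {set 'I_n}} :=
  [set [set u; v]%SET | u in K, v in V]%SET.

Lemma cut_sub_possible_edges K V : [disjoint K & V] ->
  cut K V \subset possible_edges n.
Proof.
move=> dKV; apply/fintype.subsetP => e /imset2P[u v uK vV ->].
rewrite finset.inE cards2; case: (eqVneq u v) => // uv.
by move: vV; rewrite -uv (disjointFr dKV uK).
Qed.

(** Disjointness makes the map from (u, v) to the edge {u, v} injective: the endpoint in K can be
    told from the one in V. *)
Lemma card_cut K V : [disjoint K & V] -> #|cut K V| = (#|K| * #|V|)%N.
Proof.
move=> dKV; rewrite /cut curry_imset2X card_in_imset ?cardsX//.
move=> [u v] [u' v'] /finset.setXP[/= uK vV] /finset.setXP[/= u'K v'V] uvE.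
have neq x y : x \in K -> y \in V -> (x == y) = false.
  by move=> xK yV; apply/eqP => xy; rewrite -xy (disjointFr dKV xK) in yV.
have : u \in [set u'; v']%SET by rewrite -uvE finset.set21.
have : v \in [set u'; v']%SET by rewrite -uvE finset.set22.
rewrite !finset.in_set2 [v == u']eq_sym (neq u' v)// (neq u v')// orbF => /eqP-> /eqP->.
by [].
Qed.

Lemma disjoint_cut K V E : [disjoint cut K V & E] =
  [forall v in V, ~~ [exists u, (u \in K) && adj E v u]].
Proof.
apply/idP/forall_inP => [dE v vV|noE].
  apply/existsPn => u; apply/negP => /andP[uK].
  rewrite /adj finset.setUC => uvE.
  suff : [set u; v]%SET \in cut K V by rewrite (disjointFl dE uvE).
  by apply/imset2P; exists u v.
apply/pred0P => e; apply/negbTE/negP => /andP[/= /imset2P[u v uK vV ->] uvE].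
have /existsPn/(_ u) := noE v vV.
by rewrite uK /adj finset.setUC uvE.
Qed.

End Cut.

(** * First moment bounds for domination *)

Section DominationProb.
Context {R : realType} {n : nat}.
Implicit Types (q : R) (K V : {set 'I_n}).

(** The event says that all edges of [cut K V] are absent. *)
Lemma gnp_prob_isolated q K V : [disjoint K & V] ->
  gnp_prob q (fun e => [forall v in V, ~~ [exists u, (u \in K) && e v u]]) =
  (1 - q) ^+ (#|K| * #|V|).
Proof.
move=> dKV; rewrite -(card_cut _ _ dKV).
rewrite -(sum_subset_weight_disjoint _ _ _ (cut_sub_possible_edges _ _ dKV)).
by rewrite gnp_probE; apply: eq_bigl => E; rewrite disjoint_cut.
Qed.

(* Inclusion-exclusion over the sets V of undominated vertices outside K. *)
Lemma gnp_prob_dominating q K :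
  gnp_prob q (fun e => dominating e K) = (1 - (1 - q) ^+ #|K|) ^+ #|~: K|%SET.
Proof.
pose hit E v := [exists u, (u \in K) && adj E v u].
(* [F E v + 1] is the indicator that v lies in K or has a neighbor there; [F'] replaces the
   indicator of failure by its probability. *)
pose F E v : R := if v \in K then 0 else - (~~ hit E v)%:R.
pose F' v : R := if v \in K then 0 else - (1 - q) ^+ #|K|.
have domE E : (dominating (adj E) K)%:R = \prod_v (F E v + 1).
  case: (boolP (dominating _ _)) => [/forallP domK|].
    rewrite big1// => v _; rewrite /F; case: ifPn => [_|vK]; first by rewrite add0r.
    by rewrite /hit (implyP (domK v) vK) oppr0 add0r.
  rewrite negb_forall => /existsP[v]; rewrite negb_imply => /andP[vK nhit].
  by rewrite (bigD1 v)//= /F (negPf vK) /hit nhit addNr mul0r.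
transitivity (\prod_v (F' v + 1)); last first.
  rewrite -prodr_const [RHS]big_mkcond; apply: eq_bigr => v _.
  by rewrite finset.in_setC /F'; case: ifP => _ /=; ring.
rewrite gnp_probE bigA_distr.
transitivity (\sum_E subset_weight (possible_edges n) q E *
    \sum_(V : {set 'I_n}) \prod_v (if v \in V then F E v else 1)).
  rewrite big_mkcond; apply: eq_bigr => E _.
  rewrite -bigA_distr -domE; case: ifP => _; by rewrite ?mulr1 ?mulr0.
under [LHS]eq_bigr do rewrite mulr_sumr.
rewrite exchange_big; apply: eq_bigr => V _ /=.
(* If V meets K, both sides vanish, since [F] and [F'] are 0 on K. *)
have [dKV|] := boolP [disjoint K & V]; last first.
  case/pred0Pn => v /andP[/= vK vV].
  rewrite [RHS](bigD1 v)//= vV /F' vK mul0r big1// => E _.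
  by rewrite (bigD1 v)//= vV /F vK mul0r mulr0.
have prodV (G : 'I_n -> R) :
    \prod_v (if v \in V then if v \in K then 0 else - G v else 1) =
    (-1) ^+ #|V| * \prod_(v in V) G v.
  rewrite -prodrN [RHS]big_mkcond; apply: eq_bigr => v _.
  by case: ifP => // /(disjointFl dKV) ->.
rewrite prodV prodr_const -exprM -gnp_prob_isolated// gnp_probE mulr_sumr.
rewrite [RHS]big_mkcond; apply: eq_bigr => E _.
rewrite prodV; case: ifPn => [/forall_inP nhit|].
  by rewrite big1 ?mulr1 1?mulrC// => v /nhit; rewrite /hit => ->.
rewrite negb_forall => /existsP[v]; rewrite negb_imply negbK => /andP[vV hv].
by rewrite (bigD1 v)//= /hit hv mul0r !mulr0.
Qed.

(** Markov's inequality for the number of vertices outside K that K does not dominate: its mean is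
    at most the right-hand side, and it exceeds a on the event. *)
Lemma gnp_prob_domination_gt q K (a : R) : 0 <= q <= 1 -> 0 <= a ->
  a * gnp_prob q (fun e : rel 'I_n => #|K|%:R + a < (domination_number e)%:R) <=
  n%:R * (1 - q) ^+ #|K|.
Proof.
move=> q01 a0.
pose iso v (e : rel 'I_n) := (v \notin K) && ~~ [exists u, (u \in K) && e v u].
have pq : 0 <= 1 - q by case/andP: q01 => _; rewrite subr_ge0.
apply: (@le_trans _ _ (\sum_v gnp_prob q (iso v))); last first.
  rewrite -[X in X%:R * _]card_ord -[X in X%:R * _]sum1_card natr_sum mulr_suml.
  apply: ler_sum => v _; rewrite mul1r.
  have [vK|vK] := boolP (v \in K).
    by rewrite /gnp_prob big1 ?exprn_ge0// => E; rewrite /iso vK andbF.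
  have dKv : [disjoint K & [set v]%SET] by rewrite disjoint_sym disjoints1.
  have := gnp_prob_isolated q _ _ dKv; rewrite cards1 muln1 => <-.
  apply: le_gnp_prob => // e /andP[_ ne].
  by apply/forall_inP => w; rewrite finset.in_set1 => /eqP->.
under [leRHS]eq_bigr do rewrite gnp_probE big_mkcond.
rewrite exchange_big gnp_probE mulr_sumr [leLHS]big_mkcond.
apply: ler_sum => E _ /=; rewrite -big_mkcond /= sumr_const.
have w0 := subset_weight_ge0 (possible_edges n) q E q01.
case: ifPn => [lt_dom|_]; last by rewrite mulrn_wge0.
rewrite -mulr_natl ler_wpM2r//.
have := domination_number_le_undominated (adj E) K.
rewrite cardsE -(ler_nat R) natrD; move: lt_dom; rewrite /iso /=.
by lra.
Qed.

(** Union bound over the candidates for a minimum dominating set. *)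
Lemma gnp_prob_domination_le q (k : nat) : 0 <= q <= 1 ->
  gnp_prob q (fun e : rel 'I_n => (domination_number e <= k)%N) <=
  \sum_(K : {set 'I_n} | (#|K| <= k)%N) (1 - (1 - q) ^+ #|K|) ^+ (n - #|K|).
Proof.
move=> q01.
rewrite (eq_bigr (fun K => gnp_prob q (fun e => dominating e K))); last first.
  move=> K _; rewrite gnp_prob_dominating; congr (_ ^+ _).
  by rewrite -[X in (X - _)%N]card_ord -(cardsC K) addKn.
under [leRHS]eq_bigr do rewrite gnp_probE big_mkcond.
rewrite exchange_big gnp_probE [leLHS]big_mkcond.
apply: ler_sum => E _ /=.
have w0 := subset_weight_ge0 (possible_edges n) q E q01.
case: ifPn => [|_]; last by apply: sumr_ge0 => K _; case: ifP.
have [K domK <- Kk] := domination_number_attained (adj E).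
rewrite (bigD1 K)//= domK ler_wpDr//.
by apply: sumr_ge0 => K' _; case: ifP.
Qed.

End DominationProb.

(** * Tails of the domination number at p and 2p *)

Section Estimates.
Context {R : realType}.
Implicit Types (p q x : R) (n k : nat).

Lemma card_small_subsets_le n k x : 1 <= x ->
  #|[set K : {set 'I_n} | (#|K| <= k)%N]%SET|%:R <= x ^+ k * (1 + x^-1) ^+ n.
Proof.
move=> x1; have x0 : 0 < x by lra.
have -> : (1 + x^-1) ^+ n = \sum_(K : {set 'I_n}) x^-1 ^+ #|K|.
  transitivity (\prod_(i < n) (x^-1 + 1)).
    by rewrite prodr_const card_ord addrC.
  rewrite bigA_distr; apply: eq_bigr => K _.
  by rewrite -big_mkcond prodr_const.
(* Each set K with #|K| <= k is counted with weight x ^ (k - #|K|) >= 1. *)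
rewrite mulr_sumr -sum1dep_card natr_sum big_mkcond.
apply: ler_sum => K _; rewrite exprVn.
case: ifP => [Kk|_]; last by rewrite divr_ge0// exprn_ge0// ltW.
by rewrite ler_pdivlMr ?exprn_gt0// mul1r ler_weXn2l.
Qed.

(* Used with x = n q, for which n / x = 1 / q is negligible, whereas the trivial
   bound n ^ k on the number of sets would lose too much when n q grows slowly. *)
Lemma gnp_prob_domination_le_exp n q k x :
  0 <= q <= 1 -> 1 <= x -> (k <= n)%N ->
  gnp_prob q (fun e : rel 'I_n => (domination_number e <= k)%N) <=
  expR (k%:R * ln x + n%:R / x - (n%:R - k%:R) * (1 - q) ^+ k).
Proof.
move=> q01 x1 kn; have x0 : 0 < x by lra.
apply: le_trans (gnp_prob_domination_le _ _ q01) _.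
rewrite expRD expRD expRM_natl lnK ?posrE//.
apply: (@le_trans _ _ (#|[set K : {set 'I_n} | (#|K| <= k)%N]%SET|%:R *
    expR (- ((n%:R - k%:R) * (1 - q) ^+ k)))); last first.
  rewrite ler_wpM2r ?expR_ge0//.
  apply: le_trans (card_small_subsets_le n k x x1) _.
  rewrite ler_wpM2l ?exprn_ge0 ?(ltW x0)// expRM_natl.
  by rewrite lerXn2r ?nnegrE ?expR_ge0 ?expR_ge1Dx ?addr_ge0 ?invr_ge0 ?(ltW x0).
rewrite -sum1dep_card natr_sum mulr_suml.
apply: ler_sum => K Kk; rewrite mul1r.
have [q0 q1] := andP q01.
have p0 : 0 <= 1 - q by lra.
have pKk : (1 - q) ^+ k <= (1 - q) ^+ #|K| by rewrite ler_wiXn2l//; lra.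
have pk0 : 0 <= (1 - q) ^+ k by rewrite exprn_ge0.
have pK1 : (1 - q) ^+ #|K| <= 1 by rewrite exprn_ile1//; lra.
apply: (@le_trans _ _ (expR (- (1 - q) ^+ k) ^+ (n - #|K|))).
  rewrite lerXn2r ?nnegrE ?expR_ge0 ?subr_ge0//.
  by apply: le_trans (expR_ge1Dx _); lra.
rewrite -expRM_natl ler_expR natrB ?(leq_trans Kk)// mulrN lerN2 ler_wpM2r//.
by rewrite lerD2l lerN2 ler_nat.
Qed.

(** Inverts [1 + x <= expR x] at x = p / (1 - p), where the left side is 1 / (1 - p). *)
Lemma onem_ge_expR p : p < 1 -> expR (- (p / (1 - p))) <= 1 - p.
Proof.
move=> p1; have p0 : 0 < 1 - p by lra.
rewrite expRN -[leRHS]invrK lef_pV2 ?posrE ?expR_gt0 ?invr_gt0//.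
apply: le_trans (expR_ge1Dx _).
suff -> : 1 + p / (1 - p) = (1 - p)^-1 by [].
by field; rewrite gt_eqF.
Qed.

Lemma expR_ge_sqr x : 0 <= x -> (1 + x / 2) ^+ 2 <= expR x.
Proof.
move=> x0; have -> : expR x = expR (x / 2) ^+ 2 by rewrite -expRM_natl; congr expR; field.
by rewrite lerXn2r ?nnegrE ?expR_ge0 ?expR_ge1Dx//; lra.
Qed.

Lemma expR_ge_cube x : 0 <= x -> (1 + x / 3) ^+ 3 <= expR x.
Proof.
move=> x0; have -> : expR x = expR (x / 3) ^+ 3 by rewrite -expRM_natl; congr expR; field.
by rewrite lerXn2r ?nnegrE ?expR_ge0 ?expR_ge1Dx//; lra.
Qed.

Lemma ln_double_expR_le x : ln (2 * expR x) <= x + 1.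
Proof.
rewrite -ler_expR lnK ?posrE ?mulr_gt0 ?expR_gt0// expRD mulrC ler_pM2l ?expR_gt0//.
by have := expR_ge1Dx (1 : R); lra.
Qed.

Lemma expR_ge_linear x : 50 <= x -> 4 * x + 100 <= expR x.
Proof.
move=> x50; have x0 : 0 <= x by lra.
apply: le_trans (expR_ge_sqr x x0).
have : 50 * x <= x * x by rewrite ler_wpM2r.
lra.
Qed.

(** In the exponential first moment bound with x = np, the choice of sets costs about L^2 / p, while
    the gain is at least e^(L/16) / (2p). *)
Lemma domination_number_lower_tail n p L : 0 < p -> p <= 1 / 20 ->
  n%:R * p = expR L -> 500 * 500 <= L ->
  gnp_prob p (fun e : rel 'I_n => (domination_number e)%:R <= 7 / 8 * L / p) <= 1 / 4.
Proof.
move=> p_gt0 p_le np_expR L_ge.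
have np_ge := expR_ge_linear L ltac:(lra); rewrite -np_expR in np_ge.
have np_gt0 : 0 < n%:R * p by rewrite np_expR expR_gt0.
set y := 7 / 8 * L / p.
have y0 : 0 <= y by rewrite /y !mulr_ge0 ?invr_ge0//; lra.
have yp : y * p = 7 / 8 * L by rewrite /y mulfVK// gt_eqF.
clearbody y.
pose k := Num.truncn y.
have ky : k%:R <= y by rewrite truncn_le.
have leyE m : (m%:R <= y) = (m <= k)%N by rewrite truncn_ge_nat.
clearbody k.
have yn : y <= n%:R / 2.
  by rewrite -(ler_pM2r p_gt0) yp; lra.
have kn : (k <= n)%N by rewrite -(ler_nat R); have : 0 <= n%:R :> R by []; lra.
have q01 : 0 <= p <= 1 by lra.
have -> : gnp_prob p (fun e : rel 'I_n => (domination_number e)%:R <= y) =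
          gnp_prob p (fun e : rel 'I_n => (domination_number e <= k)%N).
  by rewrite !gnp_probE; apply: eq_bigl => E; rewrite leyE.
have x1 : 1 <= n%:R * p by lra.
apply: le_trans (gnp_prob_domination_le_exp n p k (n%:R * p) q01 x1 kn) _.
have n0 : n%:R != 0 :> R by apply/eqP => n0; move: np_gt0; rewrite n0; lra.
have -> : n%:R / (n%:R * p) = p^-1 by field; rewrite n0 gt_eqF.
rewrite np_expR expRK.
(* As p <= 1/20, kp / (1 - p) is at most 7/8 * 20/19 * L, which is below 15/16 * L. *)
have pk : expR (- (15 / 16 * L)) <= (1 - p) ^+ k.
  apply: (@le_trans _ _ (expR (- (p / (1 - p))) ^+ k)); last first.
    by rewrite lerXn2r ?nnegrE ?expR_ge0 ?onem_ge_expR//; lra.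
  rewrite -expRM_natl ler_expR mulrN lerN2 mulrA ler_pdivrMr; last by lra.
  have : k%:R * p <= 7 / 8 * L by rewrite -yp ler_pM2r.
  nra.
have E16 : n%:R * p * expR (- (15 / 16 * L)) = expR (L / 16).
  by rewrite np_expR -expRD; congr expR; field.
(* This fixes the threshold 500 * 500: it gives u >= 5000, so u^3 >= 5000 u^2 beats 2 L^2, which is
   at most 2 * 48^2 u^2 = 4608 u^2. *)
have big : L ^+ 2 + 4 <= expR (L / 16) / 2.
  have L16 : 0 <= L / 16 by lra.
  have := expR_ge_cube _ L16.
  set u := 1 + _ => hu.
  have Lu : L = 48 * (u - 1) by rewrite /u; field.
  have u5 : 50 * 100 <= u by rewrite /u; lra.
  have : 50 * 100 * u ^+ 2 <= u ^+ 3 by rewrite [u ^+ 3]exprS ler_wpM2r ?sqr_ge0.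
  have := sqr_ge0 u; move: (u) Lu u5 hu => {}u -> u5 hu u2 u3; lra.
have nk : n%:R / 2 <= n%:R - k%:R :> R by lra.
have main : n%:R / 2 * expR (- (15 / 16 * L)) <= (n%:R - k%:R) * (1 - p) ^+ k.
  by rewrite ler_pM ?expR_ge0// divr_ge0.
have expo : k%:R * L + p^-1 - (n%:R - k%:R) * (1 - p) ^+ k <= - 3.
  rewrite -(ler_pM2r p_gt0) mulrBl mulrDl mulVf ?gt_eqF//.
  have e1 : k%:R * L * p <= L ^+ 2.
    have : k%:R * p <= L by apply: (le_trans (ler_wpM2r (ltW p_gt0) ky)); rewrite yp; lra.
    have : 0 <= L by lra.
    nra.
  have e2 : expR (L / 16) / 2 <= (n%:R - k%:R) * (1 - p) ^+ k * p.
    rewrite -E16; apply: le_trans (ler_wpM2r (ltW p_gt0) main); lra.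
  lra.
apply: (@le_trans _ _ (expR (- 3))); first by rewrite ler_expR.
rewrite expRN div1r lef_pV2 ?posrE ?expR_gt0//.
have := expR_ge1Dx (3 : R); lra.
Qed.

(** The constant 3 is 2 for the repaired vertices plus 1 for rounding the size of the fixed set, as
    1 <= 1/p. *)
Lemma domination_number_upper_tail n p L : 0 < p -> p <= 1 / 20 ->
  n%:R * p = expR L -> 50 <= L ->
  gnp_prob (2 * p) (fun e : rel 'I_n =>
    (ln (2 * (n%:R * p)) / 2 + 3) / p < (domination_number e)%:R) <= 1 / 4.
Proof.
move=> p_gt0 p_le np_expR L_ge.
have np_ge := expR_ge_linear L L_ge; rewrite -np_expR in np_ge.
have np_gt0 : 0 < n%:R * p by rewrite np_expR expR_gt0.
set l := ln _.
have l_expR : expR l = 2 * (n%:R * p) by rewrite lnK// posrE mulr_gt0.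
have l_ge0 : 0 <= l by rewrite ln_ge0//; lra.
have l_le : l <= L + 1 by rewrite /l np_expR ln_double_expR_le.
clearbody l.
(* At this size e^(-2py) = 1 / (2np), so on average at most 1 / (2p) vertices stay undominated. *)
pose y := l / (2 * p).
have y0 : 0 <= y by rewrite /y divr_ge0//; lra.
have yp : y * p = l / 2 by rewrite /y; field; rewrite gt_eqF.
clearbody y.
pose k := (Num.truncn y).+1.
have ky : k%:R <= y + 1 by rewrite /k -natr1 lerD2r truncn_le.
have yk : y < k%:R by exact: truncnS_gt.
clearbody k.
have kn : (k <= n)%N.
  rewrite -(ler_nat R); apply: (le_trans ky).
  by rewrite -(ler_pM2r p_gt0) mulrDl yp mul1r; lra.
have n0 : n%:R != 0 :> R by apply/eqP => n0; move: np_gt0; rewrite n0 mul0r ltxx.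
have pk : n%:R * (1 - 2 * p) ^+ k <= 1 / (2 * p).
  have h1 : (1 - 2 * p) ^+ k <= expR (- l).
    apply: (@le_trans _ _ (expR (- (2 * p)) ^+ k)).
      by rewrite lerXn2r ?nnegrE ?expR_ge0 ?expR_ge1Dx//; lra.
    rewrite -expRM_natl ler_expR mulrN lerN2.
    have := ler_wpM2r (ltW p_gt0) (ltW yk); rewrite yp; lra.
  apply: le_trans (ler_wpM2l (ler0n _ _) h1) _.
  rewrite expRN l_expR le_eqVlt; apply/orP; left; apply/eqP.
  by field; rewrite n0 gt_eqF.
pose K : {set 'I_n} := [set i : 'I_n | (i < k)%N]%SET.
have Kk : #|K| = k.
  by rewrite -sum1dep_card -(big_ord_widen _ (fun=> 1%N) kn) sum1_card card_ord.
have q01 : 0 <= 2 * p <= 1 by lra.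
(* Markov's inequality with a = 2/p gives (1 / (2p)) / (2 / p) = 1/4. *)
have a0 : 0 <= 2 / p by rewrite divr_ge0// ltW.
have := gnp_prob_domination_gt (2 * p) K (2 / p) q01 a0; rewrite Kk => tail.
apply: (@le_trans _ _ (gnp_prob (2 * p)
    (fun e : rel 'I_n => k%:R + 2 / p < (domination_number e)%:R))).
  apply: le_gnp_prob => // e; apply: le_lt_trans.
  rewrite -(ler_pM2r p_gt0) mulrDl !divfK ?gt_eqF//.
  have := ler_wpM2r (ltW p_gt0) ky; rewrite mulrDl yp; lra.
move: (le_trans tail pk) => {tail pk}; set P := gnp_prob _ _.
rewrite ler_pdivlMr; last by lra.
have -> : 2 / p * P * (2 * p) = 4 * P by field; rewrite gt_eqF.
lra.
Qed.

End Estimates.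

(** * Overlap of likely events at nearby edge probabilities *)

Section Overlap.
Context {R : realType} {n : nat}.
Implicit Types (p q : R) (A B : pred (rel 'I_n)).

Lemma card_possible_edges_le : (#|possible_edges n| * 2 <= n ^ 2)%N.
Proof.
rewrite card_draws card_ord bin2 muln2.
apply: leq_trans (_ : n * n.-1 <= _)%N; last by rewrite expnS expn1 leq_mul ?leq_pred.
by rewrite -[leqRHS]odd_double_half leq_addl.
Qed.

Lemma gnp_prob_meet_close p q q' A B : 0 < p -> p <= q <= 1 / 10 -> 0 <= q' <= 1 ->
  n%:R ^+ 2 * (q' - q) ^+ 2 <= p ->
  3 / 4 < gnp_prob q A -> 3 / 4 < gnp_prob q' B -> exists e, A e /\ B e.
Proof.
move=> p_gt0 /andP[pq q_le] q'01 step PA PB; apply: contrapT => noe.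
have sub : gnp_prob q' B <= gnp_prob q' (predC A).
  by apply: le_gnp_prob => // e Be; apply/negP => Ae; apply: noe; exists e.
have q01 : 0 < q < 1 by lra.
have := gnp_prob_close q q' (predC A) q01 q'01.
have := gnp_probC q A; move: PA (lt_le_trans PB sub).
move: (gnp_prob q A) (gnp_prob q (predC A)) (gnp_prob q' (predC A)) => a b b'.
set c := _ / (q * _); set N := #|possible_edges n|.
have c_le : c * (n%:R ^+ 2) <= 10 / 9.
  rewrite /c mulrAC ler_pdivrMr; last by rewrite mulr_gt0; lra.
  rewrite mulrC; apply: (le_trans step).
  have : 0 <= q * (1 / 10 - q) by rewrite mulr_ge0; lra.
  lra.
have c_ge0 : 0 <= c by rewrite divr_ge0 ?sqr_ge0// mulr_ge0; lra.
have N_le : N%:R * 2 <= n%:R ^+ 2 :> R.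
  by rewrite -natrM -natrX ler_nat card_possible_edges_le.
clearbody c N.
have cN : N%:R * c <= 5 / 9.
  have := ler_wpM2l c_ge0 N_le; lra.
(* With 9/4, [gnp_prob_close] reads 2b' <= 3b + 3/4; as b < 1/4, this contradicts b' > 3/4. *)
have : (1 + c) ^+ N <= 9 / 4; last by move: (_ ^+ N) => Z; lra.
apply: (@le_trans _ _ (expR c ^+ N)).
  by rewrite lerXn2r ?nnegrE ?expR_ge0 ?expR_ge1Dx//; lra.
rewrite -expRM_natl; apply: (@le_trans _ _ (expR (5 / 9))); first by rewrite ler_expR.
rewrite -[expR _]invrK -expRN invf_ple ?posrE ?expR_gt0//.
by apply: le_trans (expR_ge1Dx _); lra.
Qed.

End Overlap.

(** * Moving the edge probability from p to 2p *)

Section Nonconcentration.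
Context {R : realType}.
Implicit Types (p q L : R) (n : nat).

(** One length bound serves all q in [p, 2p]. Writing p^(3/2) as sqrt(p) * p isolates n sqrt(p),
    which cancels against the number of steps. *)
Lemma interval_length_le n p q L : 0 < p -> p <= q <= 2 * p ->
  n%:R * p = expR L -> 0 <= L ->
  1 / 4 * ln (n%:R * q) / (n%:R * q `^ (3 / 2)) <=
  (L + 1) / (4 * (n%:R * Num.sqrt p) * p).
Proof.
move=> p_gt0 /andP[pq qp] npE L_ge0.
have q_gt0 : 0 < q by lra.
have np_gt0 : 0 < n%:R * p by rewrite npE expR_gt0.
have n_gt0 : 0 < n%:R :> R by rewrite -(pmulr_lgt0 _ p_gt0).
have lnq : ln (n%:R * q) <= L + 1.
  have : ln (n%:R * q) <= ln (2 * (n%:R * p)).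
    by rewrite ler_ln ?posrE ?mulr_gt0// mulrCA ler_pM2l.
  by rewrite npE => /le_trans; apply; exact: ln_double_expR_le.
have -> : 4 * (n%:R * Num.sqrt p) * p = 4 * (n%:R * p `^ (3 / 2)).
  have -> : 3 / 2 = 1 + 2^-1 :> R by field.
  rewrite powRD ?powRr1 ?powR12_sqrt ?(ltW p_gt0)//; first by ring.
  by rewrite gt_eqF ?implybT.
have pq32 : p `^ (3 / 2) <= q `^ (3 / 2).
  by apply: ge0_ler_powR; rewrite ?nnegrE//; lra.
have p32 : 0 < p `^ (3 / 2) by rewrite powR_gt0.
have q32 : 0 < q `^ (3 / 2) by rewrite powR_gt0.
rewrite [leRHS](_ : _ = 1 / 4 * (L + 1) / (n%:R * p `^ (3 / 2))); last first.
  by rewrite invfM mulrA; congr (_ / _); lra.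
apply: ler_pM.
- have : 0 <= ln (n%:R * q); last by lra.
  by rewrite ln_ge0// (le_trans _ (_ : n%:R * p <= _)) ?ler_pM2l// npE -expR0 ler_expR.
- by rewrite invr_ge0 mulr_ge0 ?(ltW n_gt0) ?(ltW q32).
- by lra.
- by rewrite lef_pV2 ?posrE ?mulr_gt0// ler_pM2l.
Qed.

Lemma domination_number_not_concentrated n p L : 0 < p -> p <= 1 / 20 ->
  n%:R * p = expR L -> 500 * 500 <= L ->
  exists2 q, p <= q <= 2 * p &
    forall s t, s <= t ->
      t - s <= 1 / 4 * ln (n%:R * q) / (n%:R * q `^ (3 / 2)) ->
      gnp_prob q (fun e : rel 'I_n => s <= (domination_number e)%:R <= t) <= 3 / 4.
Proof.
move=> p_gt0 p_le npE L_ge; apply: contrapT => conc.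
have L_ge0 : 0 <= L by lra.
have np_ge : 100 <= n%:R * p.
  by rewrite npE; apply: le_trans (expR_ge_linear L _); lra.
set sq := Num.sqrt p.
have sq_gt0 : 0 < sq by rewrite sqrtr_gt0.
have sqE : sq ^+ 2 = p by rewrite sqr_sqrtr// ltW.
have nsq_ge : 100 <= n%:R * sq.
  apply: (le_trans np_ge); rewrite ler_wpM2l// -sqE expr2 ler_piMr ?(ltW sq_gt0)//.
  by rewrite -(@expr_le1 _ 2)// ?ltW// sqE; lra.
(* The number of steps exceeds n sqrt(p), so each step p/m is below sqrt(p)/n. *)
pose m := (Num.truncn (n%:R * sq)).+1.
have m_gt : n%:R * sq < m%:R by exact: truncnS_gt.
have m_le : m%:R <= n%:R * sq + 1.
  by rewrite /m -natr1 lerD2r truncn_le; lra.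
clearbody m.
have m_gt0 : 0 < m%:R :> R by lra.
pose q_ (i : nat) := p + i%:R * (p / m%:R).
have q_itv i : (i <= m)%N -> p <= q_ i <= 2 * p.
  rewrite -(ler_nat R) => im; rewrite /q_.
  have pm : 0 < p / m%:R by rewrite divr_gt0.
  have : 0 <= i%:R * (p / m%:R) by rewrite mulr_ge0// ltW.
  have : i%:R * (p / m%:R) <= p.
    by rewrite mulrCA ler_piMr ?(ltW p_gt0)// ler_pdivrMr// mul1r.
  lra.
pose len := (L + 1) / (4 * (n%:R * sq) * p).
have len_ge0 : 0 <= len by rewrite divr_ge0 ?mulr_ge0 ?(ltW sq_gt0) ?(ltW p_gt0)//; lra.
pose I (st : R * R) : pred (rel 'I_n) :=
  fun e => st.1 <= (domination_number e)%:R <= st.2.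
have /choice[f fP] : forall i : nat, exists st : R * R, (i <= m)%N ->
    st.2 - st.1 <= len /\ 3 / 4 < gnp_prob (q_ i) (I st).
  (* Beyond m the pair (0, 0) is a dummy, making the choice function total. *)
  move=> i; have [im|] := leqP i m; last by exists (0, 0).
  apply: contrapT => noI; apply: conc; exists (q_ i); first exact: q_itv.
  move=> s t st tsle; rewrite leNgt; apply/negP => gtI; apply: noI.
  exists (s, t) => _; split => //=.
  by apply: (le_trans tsle); apply: interval_length_le => //; exact: q_itv.
(* Consecutive intervals share a value of the domination number, so the left endpoint drops by at
   most one length. *)
have step i : (i < m)%N -> (f i).1 <= (f i.+1).1 + len.
  move=> im; have [_ Pi] := fP i (ltnW im); have [leni Pi1] := fP i.+1 im.
  have [pqi qip] := andP (q_itv i (ltnW im)).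
  have [pqi1 qi1p] := andP (q_itv i.+1 im).
  have q_le : p <= q_ i <= 1 / 10 by rewrite pqi; lra.
  have q01 : 0 <= q_ i.+1 <= 1 by lra.
  have small : n%:R ^+ 2 * (q_ i.+1 - q_ i) ^+ 2 <= p.
    rewrite /q_ -natr1 (_ : _ - _ = p / m%:R); last by ring.
    rewrite -exprMn -sqE lerXn2r ?nnegrE ?(ltW sq_gt0)//.
      by rewrite mulr_ge0// divr_ge0 ?sqr_ge0// ltW.
    by rewrite mulrA ler_pdivrMr// expr2 mulrA mulrC ler_pM2l// ltW.
  have [e [/andP[h1 _] /andP[_ h2]]] :=
    gnp_prob_meet_close _ _ _ _ _ p_gt0 q_le q01 small Pi Pi1.
  by have := le_trans h1 h2; lra.
have chain i : (i <= m)%N -> (f 0).1 <= (f i).1 + i%:R * len.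
  elim: i => [|i IH] im; first by rewrite mul0r addr0.
  have := step i im; have := IH (ltnW im); rewrite -natr1 mulrDl mul1r; lra.
have [len0 P0] := fP 0 (leq0n m); have [_ Pm] := fP m (leqnn m).
(* The tail's complement has probability at least 3/4 and the interval more than 3/4, so they meet;
   likewise at 2p. *)
have low : 7 / 8 * L / p <= (f 0).2.
  have := domination_number_lower_tail n p L p_gt0 p_le npE L_ge.
  set A := (fun e => _) => PA.
  have q01 : 0 <= p <= 1 by lra.
  have q0 : q_ 0 = p by rewrite /q_ mul0r addr0.
  rewrite q0 in P0; have PAC := gnp_probC p A.
  have [|e [/andP[_ h1] h2]] := gnp_prob_meet p (I (f 0)) (predC A) q01.
    lra.
  by apply: (le_trans _ h1); apply: ltW; rewrite ltNge.
have up : (f m).1 <= ((L + 1) / 2 + 3) / p.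
  have := domination_number_upper_tail n p L p_gt0 p_le npE ltac:(lra).
  set A := (fun e => _) => PA.
  have q01 : 0 <= 2 * p <= 1 by lra.
  have qm : q_ m = 2 * p by rewrite /q_ mulrCA divff ?gt_eqF// mulr1; ring.
  rewrite qm in Pm; have PAC := gnp_probC (2 * p) A.
  have [|e [/andP[h1 _] h2]] := gnp_prob_meet (2 * p) (I (f m)) (predC A) q01.
    lra.
  apply: (le_trans h1); move: h2; rewrite /= -leNgt => /le_trans; apply.
  rewrite ler_pM2r ?invr_gt0// lerD2r ler_pM2r ?invr_gt0//.
  by rewrite npE ln_double_expR_le.
(* The extra length passes from the right to the left end of the first interval. As n sqrt(p) >=
   100, m + 1 is at most 9/8 * n sqrt(p). *)
have tot : (m%:R + 1) * len <= 9 / 32 * (L + 1) / p.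
  apply: (@le_trans _ _ ((9 / 8 * (n%:R * sq)) * len)).
    by rewrite ler_wpM2r//; lra.
  rewrite le_eqVlt; apply/orP; left; apply/eqP; rewrite /len.
  have : n%:R * sq != 0 by rewrite gt_eqF//; lra.
  by move: (n%:R * sq) => y y0; field; rewrite y0 gt_eqF.
(* The coefficients of L are 28/32 against 16/32 + 9/32, so large L is impossible. *)
have : 7 / 8 * L / p <= ((L + 1) / 2 + 3) / p + 9 / 32 * (L + 1) / p.
  have := chain m (leqnn m); lra.
rewrite -mulrDl ler_pM2r ?invr_gt0//; lra.
Qed.

End Nonconcentration.

(** * Passage to sequences of edge probabilities *)

Theorem lemma6 (R : realType) (eps : R) (p : nat -> R)
    (eps_gt0 : 0 < eps) (eps_le : eps <= 1 / 4)
    (p01 : forall n : nat, 0 <= p n <= 1)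
    (p_lower : much_less (fun n : nat => n%:R^-1) p)
    (p_upper : much_less p (fun=> 1)) :
  infinite_set [set n : nat | exists2 q : R, p n <= q <= 2 * p n &
    forall s t : R, s <= t ->
      t - s <= eps * ln (n%:R * q) / (n%:R * q `^ (3 / 2)) ->
      gnp_prob q (fun e : rel 'I_n => s <= (domination_number e)%:R <= t)
        <= 1 - eps]%classic.
Proof.
set S := mkset _.
have [pos_near np_cvg] := p_lower; have [_ p_cvg] := p_upper.
have p_small : \forall n \near \oo%classic, p n / 1 < 1 / 20.
  by apply: (cvgr_lt _ p_cvg); lra.
have np_large : \forall n \near \oo%classic,
    n%:R^-1 / p n < (expR (500 * 500))^-1.
  by apply: (cvgr_lt _ np_cvg); rewrite invr_gt0 expR_gt0.
(* The property holds for all large n, hence for infinitely many. *)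
have [N _ NS] : \forall n \near \oo%classic, S n.
  apply: filterS3 pos_near p_small np_large => n [n_gt0 p_gt0].
  rewrite divr1 => /ltW p_le np_lt.
  have n0 : 0 < n%:R :> R by rewrite -invr_gt0.
  have np_gt0 : 0 < n%:R * p n by rewrite mulr_gt0.
  have L_ge : 500 * 500 <= ln (n%:R * p n).
    rewrite -ler_expR lnK ?posrE// -lef_pV2 ?posrE ?expR_gt0// invfM.
    exact: ltW.
  have npE : n%:R * p n = expR (ln (n%:R * p n)) by rewrite lnK.
  have [q /andP[pq qp] qP] :=
    domination_number_not_concentrated n (p n) _ p_gt0 p_le npE L_ge.
  exists q; first by rewrite pq.
  (* The case 1/4 suffices: a smaller [eps] weakens the probability bound and, since ln(nq) >= 0,
     shortens the intervals. *)
  move=> s t st ts; apply: (@le_trans _ _ (3 / 4)); last by lra.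
  apply: qP => //; apply: (le_trans ts); rewrite -(mulrA eps) -(mulrA (1 / 4)) ler_wpM2r//.
  have np_le_nq : n%:R * p n <= n%:R * q by rewrite ler_pM2l.
  rewrite divr_ge0 ?mulr_ge0 ?powR_ge0 ?(ltW n0)//.
  apply: (@le_trans _ _ (ln (n%:R * p n))); first by lra.
  by rewrite ler_ln ?posrE//; lra.
apply: cofinite_set_infinite; first exact: infinite_nat.
apply: (sub_finite_set _ (finite_II N)) => n /= nS.
by rewrite ltnNge; apply/negP => Nn; apply: nS; exact: NS.
Qed.
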